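(* Let $m\in(0,1]$, $n\geq 2$, and let $p$ be an $n$-variate polynomial of total degree at most $\ell$, for some $d\leq\ell$. If for every $\mathbf{a}\in[-m,m]^n$ the univariate polynomial $p_{\mathbf{0},\mathbf{a}}(t)=p(\mathbf{a}t)$ is pointwise $\varepsilon$-close on the interval $t\in[-1,1]$ to a univariate polynomial of degree at most $d$, then $p$ is pointwise $\eta$-close to $p^{\leq d}$ on $[-m,m]^n$, where $\eta=2(2/m)^{2n^{18\ell}}\varepsilon$.
   Context: For $p(\mathbf{x})=\sum_{I\in\mathbb{N}^n}\alpha_I\prod_{j=1}^n x_j^{I_j}$, its truncation to degree $d$ is $p^{\leq d}(\mathbf{x})=\sum_{I:\|I\|_1\leq d}\alpha_I\prod_{j=1}^n x_j^{I_j}$. Two functions are pointwise $\varepsilon$-close on a set if their values differ by at most $\varepsilon$ in absolute value at every point of the set. *)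

(* Defs.v *)
From mathcomp Require Import all_boot all_order all_algebra.
From mathcomp Require Import mpoly.
From mathcomp Require Import reals.

Set Implicit Arguments.
Unset Strict Implicit.
Unset Printing Implicit Defensive.

Import Order.TTheory GRing.Theory Num.Theory.
Local Open Scope ring_scope.

Definition mtrunc (n : nat) (R : nzRingType) (d : nat) (p : {mpoly R[n]}) :
    {mpoly R[n]} :=
  \sum_(I <- msupp p | (mdeg I <= d)%N) p@_I *: 'X_[I].

Definition pointwise_close (R : numDomainType) (T : Type) (S : T -> Prop)
    (eps : R) (f g : T -> R) : Prop :=
  forall x : T, S x -> `|f x - g x| <= eps.

Definition cube (R : numDomainType) (n : nat) (m : R) (x : 'I_n -> R) : Prop :=
  forall i : 'I_n, - m <= x i <= m.

(* p(at), with t the formal variable of [{poly R}]; see [line_polyE]. *)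
Definition line_poly (R : comNzRingType) (n : nat) (p : {mpoly R[n]})
    (a : 'I_n -> R) : {poly R} :=
  mmap (@polyC R) (fun i => a i *: 'X) p.

Lemma line_polyE (R : comNzRingType) (n : nat) (p : {mpoly R[n]})
    (a : 'I_n -> R) (t : R) :
  (line_poly p a).[t] = p.@[fun i => a i * t].
Proof.
rewrite /line_poly /meval /mmap horner_sum; apply: eq_bigr => I _.
rewrite hornerM hornerC; congr (_ * _).
rewrite /mmap1 horner_prod; apply: eq_bigr => i _.
by rewrite horner_exp hornerZ hornerX.
Qed.

(* Main.v *)
Require Import Defs.
From mathcomp Require Import all_boot all_order all_algebra.
From mathcomp Require Import mpoly.
From mathcomp Require Import reals.
From mathcomp Require Import zify ring lra.

Import Order.TTheory GRing.Theory Num.Theory.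
Local Open Scope ring_scope.

(** On the line through [x], the error [p(x) - p^{<=d}(x)] is the sum of the
    coefficients of degree [> d] of [p(xt)], which are also those of
    [r(t) = p(xt) - q(t)] for any [q] of degree at most [d].  Choosing [q] close
    to [p(xt)], [r] has degree at most [l] and is bounded by [eps] on [[-1,1]],
    so its coefficients are bounded by a multiple of [eps] depending only on
    [l]; this multiple is far below the claimed one. *)

Lemma coef_line_poly (R : comNzRingType) (n : nat) (p : {mpoly R[n]})
    (a : 'I_n -> R) (k : nat) :
  (line_poly p a)`_k =
  \sum_(I <- msupp p | mdeg I == k) p@_I * \prod_i a i ^+ I i.
Proof.
rewrite /line_poly /mmap coef_sum [RHS]big_mkcond /=; apply: eq_bigr => I _.
have -> : mmap1 (fun i => a i *: 'X) I = (\prod_i a i ^+ I i) *: 'X^(mdeg I).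
  rewrite /mmap1 mdegE -prodrXr -scaler_prod; apply: eq_bigr => i _.
  by rewrite exprZn.
rewrite coefCM coefZ coefXn eq_sym.
by case: eqP; rewrite ?mulr1 ?mulr0.
Qed.

Lemma size_line_poly (R : comNzRingType) (n : nat) (p : {mpoly R[n]})
    (a : 'I_n -> R) : (size (line_poly p a) <= msize p)%N.
Proof.
apply/leq_sizeP => k hk; rewrite coef_line_poly big_seq_cond big1 // => I.
by case/andP => /msize_mdeg_lt hI /eqP hIk; rewrite ltnNge hIk hk in hI.
Qed.

(** Along a line through the origin, the power of [t] records the total degree, so truncating by
    total degree becomes truncating in [t]; the point [a] is reached at [t = 1]. *)
Lemma meval_mtrunc (R : comNzRingType) (n d : nat) (p : {mpoly R[n]})
    (a : 'I_n -> R) :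
  (mtrunc d p).@[a] = (take_poly d.+1 (line_poly p a)).[1].
Proof.
rewrite /mtrunc raddf_sum /= (horner_coef_wide _ (size_take_poly _ _)).
under [RHS]eq_bigr => k _.
  rewrite expr1n mulr1 coef_take_poly ltn_ord coef_line_poly big_mkcond /=.
  over.
rewrite exchange_big /= big_mkcond /=; apply: eq_bigr => I _.
rewrite mevalZ mevalX -big_mkcond /=; case: leqP => hI.
  by rewrite (big_pred1 (Ordinal (hI : (mdeg I < d.+1)%N))).
by rewrite big1 // => k /eqP hk; move: (ltn_ord k); rewrite -hk ltnS leqNgt hI.
Qed.

(* [s(t) = r(t) - 2^k r(t/2)] has degree below [k], and its coefficients
   dominate the lower ones of [r]; the top one is then read off [r(1)]. *)
Lemma sum_norm_coef_le (R : realFieldType) (k : nat) (e : R) (r : {poly R}) :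
  (size r <= k.+1)%N -> (forall t, -1 <= t <= 1 -> `|r.[t]| <= e) ->
  \sum_(i < k.+1) `|r`_i| <= 2 ^+ (k * (k + 3)) * e.
Proof.
elim: k e r => [|k IH] e r hs hr.
  have := hr 1; rewrite (horner_coef_wide _ hs) !big_ord1 !expr0 mulr1 mul1r.
  by apply; lra.
have h1 : `|r.[1]| <= e by apply: hr; lra.
have e0 : 0 <= e by apply: le_trans h1.
pose s := \poly_(i < k.+1) (r`_i * (1 - 2 ^+ (k.+1 - i))).
have sE t : s.[t] = r.[t] - 2 ^+ k.+1 * r.[t / 2].
  rewrite horner_poly !(horner_coef_wide _ hs) mulr_sumr -sumrB.
  have two_pow i : (i <= k.+1)%N ->
      2 ^+ k.+1 * (r`_i * (t / 2) ^+ i) = r`_i * 2 ^+ (k.+1 - i) * t ^+ i.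
    move=> hi; rewrite -{1}(subnK hi) exprD expr_div_n; field.
    by rewrite expf_neq0 // pnatr_eq0.
  (* The term of index [k.+1] cancels, its factor being [1 - 2 ^+ 0]. *)
  rewrite [RHS]big_ord_recr /= two_pow // subnn mulr1 subrr addr0.
  by apply: eq_bigr => i _; rewrite two_pow; [ring | exact: ltnW].
have hsb t : -1 <= t <= 1 -> `|s.[t]| <= (1 + 2 ^+ k.+1) * e.
  move=> ht; rewrite sE mulrDl mul1r; apply: le_trans (ler_normB _ _) _.
  rewrite lerD ?hr // normrM ger0_norm ?exprn_ge0 // ler_wpM2l ?exprn_ge0 //.
  by apply: hr; lra.
have low : \sum_(i < k.+1) `|r`_i| <=
    2 ^+ (k * (k + 3)) * ((1 + 2 ^+ k.+1) * e).
  (* For [i <= k] the factor [2 ^+ (k.+1 - i) - 1] is at least 1, so passing from [r] to [s] does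
     not shrink these coefficients. *)
  apply: le_trans (IH _ s (size_poly _ _) hsb); apply: ler_sum => i _.
  rewrite coef_poly ltn_ord normrM ler_peMr // distrC ler_normr.
  rewrite subSn ?leq_ord // exprS.
  have : 1 <= 2 ^+ (k - i) :> R by rewrite exprn_ege1 // ler1n.
  by move=> h; apply/orP; left; lra.
have top : `|r`_k.+1| <= e + \sum_(i < k.+1) `|r`_i|.
  have -> : r`_k.+1 = r.[1] - \sum_(i < k.+1) r`_i.
    rewrite (horner_coef_wide _ hs) big_ord_recr /= expr1n mulr1.
    under eq_bigr do rewrite expr1n mulr1.
    by rewrite addrC addrK.
  by apply: le_trans (ler_normB _ _) _; rewrite lerD // ler_norm_sum.
rewrite big_ord_recr /=.
have -> : (k.+1 * (k.+1 + 3) = k * (k + 3) + (k + k + 4))%N by lia.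
rewrite 2!exprD (exprD _ k k) exprS in low *.
set A := 2 ^+ (k * (k + 3)) in low *.
have A1 : 1 <= A by rewrite exprn_ege1 // ler1n.
have B1 : 1 <= 2 ^+ k :> R by rewrite exprn_ege1 // ler1n.
set B := 2 ^+ k in low B1 *.
have eA : e <= A * e by rewrite ler_peMl.
(* [low] and [top] bound the whole sum by [e + 2 * A * (1 + 2 * B) * e], hence by
   [(4 * B + 3) * (A * e)]; the growth of the exponent allows [16 * B * B * (A * e)]. *)
have : 0 <= (16 * (B * B) - 4 * B - 3) * (A * e) by apply: mulr_ge0; nra.
lra.
Qed.

Lemma exponent_bound (n l : nat) :
  (2 <= n)%N -> (l * (l + 3) <= 2 * n ^ (18 * l))%N.
Proof.
case: l => [|l] hn; first by rewrite mul0n.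
apply: (@leq_trans (2 * 2 ^ (18 * l.+1))); last by rewrite leq_mul2l leq_exp2r.
have hl : (l.+1 < 2 ^ l.+1)%N by rewrite ltn_expl.
(* Two factors [2 ^ l.+1], each exceeding [l.+1], already dominate the quadratic left side. *)
have -> : (18 * l.+1 = l.+1 + l.+1 + 16 * l.+1)%N by lia.
by rewrite !expnD; have : (0 < 2 ^ (16 * l.+1))%N; [rewrite expn_gt0 | nia].
Qed.

Theorem theorem1p5 (R : realType) (m : R) (n l d : nat) (eps : R)
    (p : {mpoly R[n]})
    (hm : 0 < m <= 1) (hn : (2 <= n)%N)
    (hp : (msize p <= l.+1)%N) (hd : (d <= l)%N)
    (hclose : forall a : 'I_n -> R, cube m a ->
       exists q : {poly R}, (size q <= d.+1)%N /\
         pointwise_close (fun t : R => -1 <= t <= 1) eps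
           (fun t => (line_poly p a).[t]) (fun t => q.[t])) :
  pointwise_close (@cube R n m)
    (2 * (2 / m) ^+ (2 * n ^ (18 * l))%N * eps)
    (fun x => p.@[x]) (fun x => (mtrunc d p).@[x]).
Proof.
move=> x hx; have [q [hq hclosex]] := hclose x hx.
have eps0 : 0 <= eps by apply: le_trans (hclosex 0 _) => //; lra.
set P := line_poly p x in hclosex.
pose r := P - q.
have size_r : (size r <= l.+1)%N.
  rewrite (leq_trans (size_polyD _ _)) // size_polyN geq_max.
  by rewrite (leq_trans (size_line_poly _ _ _ _)) // (leq_trans hq).
have r_bound t : -1 <= t <= 1 -> `|r.[t]| <= eps.
  by move=> ht; rewrite hornerD hornerN; apply: hclosex.
(* Truncation fixes [q], so [q] cancels and [r] has the same tail above degree [d] as [P]. *)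
have -> : p.@[x] - (mtrunc d p).@[x] = (r - take_poly d.+1 r).[1].
  rewrite meval_mtrunc -/P raddfB /= (take_poly_id hq) opprB addrA subrK.
  rewrite hornerD hornerN; congr (_ - _); rewrite line_polyE.
  by apply: meval_eq => i; rewrite mulr1.
have size_tail : (size (r - take_poly d.+1 r)%R <= l.+1)%N.
  rewrite (leq_trans (size_polyD _ _)) // size_polyN geq_max size_r.
  by rewrite (leq_trans (size_take_poly _ _)).
rewrite (horner_coef_wide _ size_tail).
apply: le_trans (ler_norm_sum _ _ _) _.
apply: (@le_trans _ _ (\sum_(i < l.+1) `|r`_i|)).
  apply: ler_sum => i _; rewrite expr1n mulr1 coefB coef_take_poly.
  by case: ifP; rewrite ?subrr ?subr0 ?normr0.
apply: le_trans (sum_norm_coef_le _ _ _ _ size_r r_bound) _.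
rewrite ler_wpM2r //.
(* Since [m <= 1], the base 2 can be raised to [2 / m] once the exponent has been enlarged to
   [N]. *)
have h2 : 2 <= 2 / m by rewrite ler_pdivlMr; nra.
set N := (2 * _)%N; have : 2 ^+ (l * (l + 3)) <= (2 / m) ^+ N.
  apply: (@le_trans _ _ (2 ^+ N)).
    by rewrite ler_weXn2l ?exponent_bound ?ler1n.
  by rewrite lerXn2r // nnegrE //; lra.
have : 0 <= (2 / m) ^+ N by rewrite exprn_ge0 //; lra.
lra.
Qed.
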